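(* Let $\mathbb{B}$ be a countable Boolean algebra of subsets of $\omega$ closed under finite differences. Then $\mathcal{A}_{\mathbb{B}}\le_s\mathcal{T}_{\mathbb{B}}$ and $\mathcal{T}_{\mathbb{B}}\le_s\mathcal{A}_{\mathbb{B}}$; that is, the mass problems of maximal almost disjoint families in $\mathbb{B}$ and of maximal $\mathbb{B}$-towers are Medvedev equivalent.
   Context: For sets $A,B\subseteq\omega$, $A\subseteq^* B$ means $A\setminus B$ is finite. With $\langle\cdot,\cdot\rangle$ the usual computable Cantor pairing function on $\omega$, a set $X\subseteq\omega$ encodes the sequence $(X_n)_{n\in\omega}$ of its columns $X_n=\{u:\langle u,n\rangle\in X\}$. A $\mathbb{B}$-tower is a set $G$ such that $G_n\in\mathbb{B}$ for all $n$, $G_0=\omega$, and for each $n$, $G_{n+1}\subseteq^* G_n$ and $G_n\setminus G_{n+1}$ is infinite. It is maximal if for each infinite $R\in\mathbb{B}$ there is $n$ such that $R\setminus G_n$ is infinite. $\mathcal{T}_{\mathbb{B}}$ is the class of sets $G$ encoding a maximal $\mathbb{B}$-tower. A sequence $(F_n)_{n\in\omega}$ of sets in $\mathbb{B}$ is almost disjoint if each $F_n$ is infinite and $F_n\cap F_k$ is finite for distinct $n,k$. It is maximal almost disjoint (MAD) if moreover for each infinite $R\in\mathbb{B}$ there is $n$ such that $R\cap F_n$ is infinite. $\mathcal{A}_{\mathbb{B}}$ is the class of sets $F$ encoding a MAD sequence in $\mathbb{B}$. A mass problem is a set of functions $\omega\to\omega$ (sets are identified with their characteristic functions). Medvedev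 reducibility: $\mathcal{C}\le_s\mathcal{D}$ if there is a Turing functional $\Theta$ such that $\Theta^g\in\mathcal{C}$ for each $g\in\mathcal{D}$. *)

(* Defs.v *)
From mathcomp Require Import all_boot.
From mathcomp Require Import boolp classical_sets cardinality.
From mathcomp Require Import measurable_structure.
From Stdlib Require List Cantor.

Set Implicit Arguments.
Unset Strict Implicit.
Unset Printing Implicit Defensive.

Local Open Scope classical_set_scope.

(** Turing functionals are presented by programs for Kleene's mu-recursive
    functions relative to an oracle. A program acts on a finite list of
    arguments; the basic functions read a missing argument as 0. *)
Inductive program : Type :=
| Zero
| Succ
| Proj (i : nat)
| Oracle
| Comp (p : program) (qs : seq program)
| Prec (p q : program)
| Mu (p : program).

(** [eval g p xs y]: the program [p] with oracle [g] halts on the arguments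
    [xs] with output [y]. *)
Inductive eval (g : nat -> nat) : program -> seq nat -> nat -> Prop :=
| eval_zero xs : eval g Zero xs 0
| eval_succ xs : eval g Succ xs (nth 0 xs 0).+1
| eval_proj i xs : eval g (Proj i) xs (nth 0 xs i)
| eval_oracle xs : eval g Oracle xs (g (nth 0 xs 0))
| eval_comp p qs xs zs y :
    List.Forall2 (fun q z => eval g q xs z) qs zs ->
    eval g p zs y -> eval g (Comp p qs) xs y
| eval_prec0 p q xs y : eval g p xs y -> eval g (Prec p q) (0 :: xs) y
| eval_precS p q n xs r y :
    eval g (Prec p q) (n :: xs) r -> eval g q [:: n, r & xs] y ->
    eval g (Prec p q) (n.+1 :: xs) y
| eval_mu p xs y :
    (forall z, z < y -> exists v, eval g p (z :: xs) v.+1) ->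
    eval g p (y :: xs) 0 -> eval g (Mu p) xs y.

Lemma eval_functional (g : nat -> nat) (p : program) (xs : seq nat)
  (y y' : nat) : eval g p xs y -> eval g p xs y' -> y = y'.
Proof.
move=> e; move: p xs y e y'.
fix IH 4 => p xs y [].
- by move=> ? ? e; inversion e.
- by move=> ? ? e; inversion e.
- by move=> ? ? ? e; inversion e.
- by move=> ? ? e; inversion e.
- move=> {}p qs {}xs zs {}y ezs ey y' e'; inversion e' as [| | | |? ? ? zs' ? ezs' ey'| | |]; subst.
  have zsE : zs = zs'.
    clear - IH ezs ezs'.
    move: qs zs ezs zs' ezs'; fix IHl 3 => qs zs [].
      by move=> zs' e; inversion e.
    move=> q z {}qs {}zs ez ezs zs' e; inversion e as [|? z' ? ? ez' ezs']; subst.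
    by rewrite (IH _ _ _ ez _ ez') (IHl _ _ ezs _ ezs').
  by subst; exact: IH ey _ ey'.
- by move=> {}p q {}xs {}y ey y' e'; inversion e'; subst; apply: IH ey _ _.
- move=> {}p q n {}xs r {}y er ey y' e'.
  inversion e' as [| | | | | |? ? ? ? r' ? er' ey'|]; subst.
  have := IH _ _ _ er _ er' => rr'; subst.
  exact: IH ey _ ey'.
- move=> {}p {}xs {}y ez ey y' e'; inversion e' as [| | | | | | |? ? ? ez' ey']; subst.
  case: (ltngtP y y') => // [lt|lt].
    by case: (ez' _ lt) => v ev; have := IH _ _ _ ey _ ev.
  by case: (ez _ lt) => v ev; have := IH _ _ _ ev _ ey'.
Qed.

Definition mass_problem := set (nat -> nat).

(** [C <=_s D]: a single functional maps every [g] in [D] to a total function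
    in [C]. *)
Definition medvedev_le (C D : mass_problem) : Prop :=
  exists Theta : program, forall g, D g ->
    exists2 h, C h & forall n, eval g Theta [:: n] (h n).

Definition charfun (X : set nat) : nat -> nat := fun n => nat_of_bool (n \in X).

Definition column (X : set nat) (n : nat) : set nat :=
  [set u | X (Cantor.to_nat (u, n))].

Definition almost_subset (X Y : set nat) : Prop := finite_set (X `\` Y).

Definition boolean_algebra (B : set (set nat)) : Prop :=
  [/\ B set0, B setT, setU_closed B, setI_closed B & setC_closed B].

Definition finite_difference_closed (B : set (set nat)) : Prop :=
  forall X Y, B X -> finite_set (X `+` Y) -> B Y.

Definition is_tower (B : set (set nat)) (G : set nat) : Prop :=
  [/\ forall n, B (column G n),
      column G 0 = setT &
      forall n, almost_subset (column G n.+1) (column G n) /\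
                infinite_set (column G n `\` column G n.+1)].

Definition is_maximal_tower (B : set (set nat)) (G : set nat) : Prop :=
  is_tower B G /\
  forall R, B R -> infinite_set R -> exists n, infinite_set (R `\` column G n).

Definition is_almost_disjoint (B : set (set nat)) (F : set nat) : Prop :=
  [/\ forall n, B (column F n),
      forall n, infinite_set (column F n) &
      forall n k, n <> k -> finite_set (column F n `&` column F k)].

Definition is_MAD (B : set (set nat)) (F : set nat) : Prop :=
  is_almost_disjoint B F /\
  forall R, B R -> infinite_set R -> exists n, infinite_set (R `&` column F n).

Definition tower_problem (B : set (set nat)) : mass_problem :=
  [set charfun G | G in is_maximal_tower B].

Definition MAD_problem (B : set (set nat)) : mass_problem :=
  [set charfun F | F in is_MAD B].

(* Main.v *)
Require Import Defs.
From mathcomp Require Import all_boot.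
From mathcomp Require Import boolp classical_sets cardinality.
From mathcomp Require Import measurable_structure.
From Stdlib Require Cantor.

(** Towers and almost disjoint sequences determine each other columnwise.
    From a tower [G] one takes the differences [G n \ G n.+1]: the tower
    being almost decreasing, the later differences are almost contained in
    [G n.+1], hence almost disjoint from this one; and
    since [G 0] is everything, the complement of [G n] is covered by the first
    [n] differences. A set that is not almost contained in some [G n] therefore
    meets one of them in an infinite set ([MAD_of_maximal_tower]).
    From an almost disjoint sequence [F] one takes the complements of the unions
    of the first [n] members: what is lost at step [n] is [F n] minus finitely
    many points, and a set meeting [F n] infinitely often is not almost contained
    in the complement of the union of the first [n.+1] members
    ([maximal_tower_of_MAD]).

    Both passages decide membership of a point with finitely many queries,
    uniformly in the given sequence, so what remains is to write them as
    mu-recursive programs. On the code [m] of [(u, n)] everything is read off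
    from the diagonal [u + n], found by unbounded search ([eval_Diag]). Boolean
    combinations become arithmetic on characteristic functions: truncated
    subtraction [a - b] is the conjunction of [a] with the negation of [b]. *)

Set Implicit Arguments.
Unset Strict Implicit.
Unset Printing Implicit Defensive.

Local Open Scope classical_set_scope.

(** * Towers and almost disjoint sequences *)

Definition of_columns (A : nat -> set nat) : set nat :=
  [set m | A (Cantor.of_nat m).2 (Cantor.of_nat m).1].

Lemma column_of_columns (A : nat -> set nat) n : column (of_columns A) n = A n.
Proof.
by rewrite /column /of_columns /mkset; under eq_fun do rewrite Cantor.cancel_of_to.
Qed.

Definition union_before (A : nat -> set nat) (n : nat) : set nat :=
  \bigcup_(k in [set k | k < n]) A k.

Lemma union_before0 A : union_before A 0 = set0.
Proof. by apply/seteqP; split => // u []. Qed.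

Lemma union_beforeS A n : union_before A n.+1 = union_before A n `|` A n.
Proof.
apply/seteqP; split => [u [k /= kn Aku]|u [[k /= kn Aku]|Anu]].
- move: kn Aku; rewrite ltnS leq_eqVlt => /orP[/eqP->|kn] Aku; first by right.
  by left; exists k.
- by exists k => //=; apply: ltnW.
- by exists n => /=.
Qed.

Lemma union_before_closed (P : set (set nat)) (A : nat -> set nat) n :
  P set0 -> setU_closed P -> (forall k, k < n -> P (A k)) ->
  P (union_before A n).
Proof.
move=> P0 PU; elim: n => [|n IH] PA; first by rewrite union_before0.
rewrite union_beforeS; apply: PU; last exact: PA.
by apply: IH => k kn; apply: PA; apply: ltnW.
Qed.

Lemma finite_union_before (A : nat -> set nat) n :
  (forall k, k < n -> finite_set (A k)) -> finite_set (union_before A n).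
Proof.
apply: (@union_before_closed finite_set) => // X Y fX fY.
by rewrite finite_setU.
Qed.

Lemma almost_subset_trans (X Y Z : set nat) :
  almost_subset X Y -> almost_subset Y Z -> almost_subset X Z.
Proof.
move=> XY YZ; apply: (@sub_finite_set _ _ ((X `\` Y) `|` (Y `\` Z))).
  by move=> u [Xu nZu]; case: (pselect (Y u)) => Yu; [right | left].
by rewrite finite_setU.
Qed.

Lemma tower_almost_decreasing (B : set (set nat)) (G : set nat) n k :
  is_tower B G -> n <= k -> almost_subset (column G k) (column G n).
Proof.
case=> _ _ Gdec; elim: k => [|k IH].
  by rewrite leqn0 => /eqP->; rewrite /almost_subset setDv.
rewrite leq_eqVlt => /orP[/eqP->|nk]; first by rewrite /almost_subset setDv.
exact: almost_subset_trans (Gdec k).1 (IH nk).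
Qed.

Definition tower_differences (G : set nat) (n : nat) : set nat :=
  column G n `\` column G n.+1.

(** A point outside [G n] left the tower at some step before [n], because it
    belongs to [G 0]. *)
Lemma setC_column_tower (G : set nat) n : column G 0 = setT ->
  ~` column G n `<=` union_before (tower_differences G) n.
Proof.
move=> G0; elim: n => [|n IH] u; first by rewrite G0; case.
move=> nGu; rewrite union_beforeS.
by case: (pselect (column G n u)) => Gu; [right | left; exact: IH].
Qed.

Lemma MAD_of_maximal_tower (B : set (set nat)) (G : set nat) :
  boolean_algebra B -> is_maximal_tower B G ->
  is_MAD B (of_columns (tower_differences G)).
Proof.
move=> [_ _ _ BI BC] [tG maxG]; have [BG G0 Gdec] := tG.
have early n k : n < k ->
    finite_set (tower_differences G n `&` tower_differences G k).
  move=> nk; apply: sub_finite_set (tower_almost_decreasing tG nk).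
  by move=> u [[_ nGu] [Gu _]].
split; first split => [n|n|n k].
- by rewrite column_of_columns /tower_differences setDE; apply: BI => //; apply: BC.
- by rewrite column_of_columns; exact: (Gdec n).2.
- rewrite !column_of_columns => /eqP; rewrite neq_ltn => /orP[|] /early //.
  by rewrite setIC.
move=> R BR Rinf; apply: contrapT => noF.
have [n] := maxG R BR Rinf; apply.
apply: (@sub_finite_set _ _
  (union_before (fun k => R `&` tower_differences G k) n)).
  by move=> u [Ru /(setC_column_tower G0)[k kn Fku]]; exists k.
apply: finite_union_before => k _; apply: contrapT => RF.
by apply: noF; exists k; rewrite column_of_columns.
Qed.

Definition complement_before (F : set nat) (n : nat) : set nat :=
  ~` union_before (column F) n.

Lemma complement_beforeD (F : set nat) n :
  complement_before F n `\` complement_before F n.+1 =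
  column F n `\` union_before (column F) n.
Proof.
rewrite /complement_before union_beforeS; apply/seteqP; split => u.
  by move=> [nU /contrapT[]].
by move=> [Fu nU]; split=> //; apply; right.
Qed.

Lemma maximal_tower_of_MAD (B : set (set nat)) (F : set nat) :
  boolean_algebra B -> is_MAD B F ->
  is_maximal_tower B (of_columns (complement_before F)).
Proof.
move=> [B0 _ BU _ BC] [[BF Finf Fdisj] maxF].
split; first split => [n||n].
- by rewrite column_of_columns; apply: BC; apply: union_before_closed.
- by rewrite column_of_columns /complement_before union_before0 setC0.
- rewrite !column_of_columns complement_beforeD; split.
    rewrite /almost_subset /complement_before union_beforeS.
    by apply: (@sub_finite_set _ _ set0) => // u [nU /contrapT Uu]; apply: nU; left.
  move=> fin; apply: (Finf n).
  apply: (@sub_finite_set _ _ ((column F n `\` union_before (column F) n) `|`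
      union_before (fun k => column F n `&` column F k) n)).
    move=> u Fu; case: (pselect (union_before (column F) n u)) => [[k kn Fku]|nU].
      by right; exists k.
    by left.
  rewrite finite_setU; split=> //; apply: finite_union_before => k kn.
  by apply: Fdisj => nk; rewrite nk ltnn in kn.
move=> R BR Rinf; have [n RF] := maxF R BR Rinf.
exists n.+1; rewrite column_of_columns => fin; apply: RF.
apply: sub_finite_set fin => u [Ru Fu]; split=> //; apply.
by rewrite union_beforeS; right.
Qed.

(** * Programs for arithmetic and the pairing function *)

Section Programs.
Variable g : nat -> nat.
Implicit Types (p q : program) (xs : seq nat).

Lemma eval_comp1 p q xs x y :
  eval g q xs x -> eval g p [:: x] y -> eval g (Comp p [:: q]) xs y.
Proof. by move=> qx; apply: eval_comp; repeat constructor. Qed.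

Lemma eval_comp2 p q1 q2 xs x1 x2 y :
  eval g q1 xs x1 -> eval g q2 xs x2 -> eval g p [:: x1; x2] y ->
  eval g (Comp p [:: q1; q2]) xs y.
Proof. by move=> qx1 qx2; apply: eval_comp; repeat constructor. Qed.

Lemma eval_proj_eq i xs x : nth 0 xs i = x -> eval g (Proj i) xs x.
Proof. by move=> <-; constructor. Qed.

Lemma eval_succ_comp q xs x :
  eval g q xs x -> eval g (Comp Succ [:: q]) xs x.+1.
Proof. by move=> qx; apply: eval_comp1 qx _; exact: eval_succ. Qed.

Lemma eval_oracle_comp q xs x :
  eval g q xs x -> eval g (Comp Oracle [:: q]) xs (g x).
Proof. by move=> qx; apply: eval_comp1 qx _; exact: eval_oracle. Qed.

Definition Pred := Prec Zero (Proj 0).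

Lemma eval_Pred x xs : eval g Pred (x :: xs) x.-1.
Proof.
elim: x => [|x IH]; first by apply: eval_prec0; constructor.
by apply: eval_precS IH _; exact: eval_proj_eq.
Qed.

Definition Add := Prec (Proj 0) (Comp Succ [:: Proj 1]).

Lemma eval_Add x y xs : eval g Add [:: x, y & xs] (x + y).
Proof.
elim: x => [|x IH]; first by apply: eval_prec0; exact: eval_proj_eq.
by apply: eval_precS IH _; apply: eval_succ_comp; exact: eval_proj_eq.
Qed.

(** The recursion is on the first argument, so the subtrahend comes first. *)
Definition Sub_from := Prec (Proj 0) (Comp Pred [:: Proj 1]).

Lemma eval_Sub_from x y xs : eval g Sub_from [:: x, y & xs] (y - x).
Proof.
elim: x => [|x IH].
  by rewrite subn0; apply: eval_prec0; exact: eval_proj_eq.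
apply: eval_precS IH _; rewrite subnS.
by apply: eval_comp1 (eval_Pred _ _); exact: eval_proj_eq.
Qed.

Definition Triangular := Prec Zero (Comp Add [:: Comp Succ [:: Proj 0]; Proj 1]).

Lemma eval_Triangular s xs : eval g Triangular (s :: xs) 'C(s.+1, 2).
Proof.
elim: s => [|s IH]; first by apply: eval_prec0; exact: eval_zero.
apply: eval_precS IH _; rewrite [X in eval _ _ _ X]binS bin1 addnC.
apply: eval_comp2 (eval_Add _ _ _); last exact: eval_proj_eq.
by apply: eval_succ_comp; exact: eval_proj_eq.
Qed.

Lemma to_natE u n : Cantor.to_nat (u, n) = n + 'C((u + n).+1, 2).
Proof.
rewrite /Cantor.to_nat [in RHS]addnC [u + n]addnC addnC plusE; congr (_ + _).
elim: (n + u) => [//|s IH] /=.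
by rewrite [RHS]binS bin1 addnC IH.
Qed.

Lemma to_nat_next_column u n :
  Cantor.to_nat (u, n.+1) = Cantor.to_nat (u, n) + (u + n).+2.
Proof. by rewrite !to_natE addnS binS bin1 addSn !addnS addnA. Qed.

(** The codes on the diagonal [s] are those below ['C(s.+2, 2)]
    and not below ['C(s.+1, 2)], so [s] is the first [z] for which
    [m.+1 - 'C(z.+2, 2)] vanishes. *)
Definition Diag :=
  Mu (Comp Sub_from [:: Comp Triangular [:: Comp Succ [:: Proj 0]];
                        Comp Succ [:: Proj 1]]).

Lemma eval_Diag u n xs : eval g Diag (Cantor.to_nat (u, n) :: xs) (u + n).
Proof.
set m := Cantor.to_nat _.
have body z : eval g (Comp Sub_from [:: Comp Triangular [:: Comp Succ [:: Proj 0]];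
    Comp Succ [:: Proj 1]]) [:: z, m & xs] (m.+1 - 'C(z.+2, 2)).
  apply: eval_comp2 (eval_Sub_from _ _ _).
    apply: eval_comp1 (eval_Triangular _ _).
    by apply: eval_succ_comp; exact: eval_proj_eq.
  by apply: eval_succ_comp; exact: eval_proj_eq.
apply: eval_mu => [z zs|].
  exists (m - 'C(z.+2, 2)); rewrite -subSn //.
  by rewrite /m to_natE; apply: leq_trans (leq_addl _ _); exact: leq_bin2l.
have := body (u + n); rewrite (_ : _ - _ = 0) //; apply/eqP.
rewrite subn_eq0 /m to_natE [in X in _ <= X]binS bin1 addnC -addnS.
by rewrite leq_add2l ltnS leq_addl.
Qed.

Definition Pairing :=
  Comp Add [:: Proj 1; Comp Triangular [:: Comp Add [:: Proj 0; Proj 1]]].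

Lemma eval_Pairing u n xs :
  eval g Pairing [:: u, n & xs] (Cantor.to_nat (u, n)).
Proof.
rewrite to_natE; apply: eval_comp2 (eval_Add _ _ _); first exact: eval_proj_eq.
apply: eval_comp1 (eval_Triangular _ _).
by apply: eval_comp2 (eval_Add _ _ _); exact: eval_proj_eq.
Qed.

Definition Snd := Comp Sub_from [:: Comp Triangular [:: Diag]; Proj 0].

Lemma eval_Snd u n xs : eval g Snd (Cantor.to_nat (u, n) :: xs) n.
Proof.
have := eval_Sub_from 'C((u + n).+1, 2) (Cantor.to_nat (u, n)) [::].
rewrite {2}to_natE addnK; apply: eval_comp2; last exact: eval_proj_eq.
by apply: eval_comp1 (eval_Triangular _ _); exact: eval_Diag.
Qed.

Definition Fst := Comp Sub_from [:: Snd; Diag].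

Lemma eval_Fst u n xs : eval g Fst (Cantor.to_nat (u, n) :: xs) u.
Proof.
have := eval_Sub_from n (u + n) [::]; rewrite addnK.
by apply: eval_comp2; [exact: eval_Snd | exact: eval_Diag].
Qed.

End Programs.

(** * The two reductions *)

Lemma charfun_column (X : set nat) u n :
  charfun X (Cantor.to_nat (u, n)) = (u \in column X n).
Proof. by congr nat_of_bool; apply/idP/idP; rewrite !inE. Qed.

(** A functional computes a set given by its columns once it does so on codes
    of pairs, since every number is one. *)
Lemma eval_of_columns (g : nat -> nat) (p : program) (A : nat -> set nat) :
  (forall u n, eval g p [:: Cantor.to_nat (u, n)] (u \in A n)) ->
  forall m, eval g p [:: m] (charfun (of_columns A) m).
Proof.
move=> pA m; rewrite -[m]Cantor.cancel_to_of.
by case: (Cantor.of_nat m) => u n; rewrite charfun_column column_of_columns.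
Qed.

(** The code of [(u, n.+1)] is obtained from that of [(u, n)] by adding
    [(u + n).+2]. *)
Definition Differences :=
  Comp Sub_from
    [:: Comp Oracle [:: Comp Add [:: Proj 0; Comp Succ [:: Comp Succ [:: Diag]]]];
        Oracle].

Lemma eval_Differences (G : set nat) u n :
  eval (charfun G) Differences [:: Cantor.to_nat (u, n)]
    (u \in tower_differences G n).
Proof.
have -> : nat_of_bool (u \in tower_differences G n) =
    charfun G (Cantor.to_nat (u, n)) - charfun G (Cantor.to_nat (u, n.+1)).
  rewrite !charfun_column /tower_differences in_setD.
  by case: (u \in column G n); case: (u \in column G n.+1).
apply: eval_comp2 (eval_Sub_from _ _ _ _); last exact: eval_oracle.
apply: eval_oracle_comp; rewrite to_nat_next_column.
apply: eval_comp2 (eval_Add _ _ _ _); first exact: eval_proj_eq.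
by do 2 apply: eval_succ_comp; exact: eval_Diag.
Qed.

(** On the arguments [n, u]: start with 1 and, for each [k] below [n], subtract
    the answer to the query whether [u] lies in column [k]; by truncation the
    result stays 0 after the first positive answer. *)
Definition Avoids :=
  Prec (Comp Succ [:: Zero])
    (Comp Sub_from
       [:: Comp Oracle [:: Comp Pairing [:: Proj 2; Proj 0]]; Proj 1]).

Lemma eval_Avoids (F : set nat) u n :
  eval (charfun F) Avoids [:: n; u] (u \in complement_before F n).
Proof.
rewrite /complement_before in_setC; elim: n => [|n IH].
  rewrite union_before0 in_set0; apply: eval_prec0.
  by apply: eval_succ_comp; exact: eval_zero.
apply: eval_precS IH _.
have -> : nat_of_bool (u \notin union_before (column F) n.+1) =
    (u \notin union_before (column F) n) - charfun F (Cantor.to_nat (u, n)).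
  rewrite charfun_column union_beforeS in_setU.
  by case: (u \in union_before _ _); case: (u \in column F n).
apply: eval_comp2 (eval_Sub_from _ _ _ _); last exact: eval_proj_eq.
apply: eval_oracle_comp.
by apply: eval_comp2 (eval_Pairing _ _ _ _); exact: eval_proj_eq.
Qed.

Definition Complements := Comp Avoids [:: Snd; Fst].

Lemma eval_Complements (F : set nat) u n :
  eval (charfun F) Complements [:: Cantor.to_nat (u, n)]
    (u \in complement_before F n).
Proof.
by apply: eval_comp2 (eval_Avoids _ _ _); [exact: eval_Snd | exact: eval_Fst].
Qed.

Theorem fact2p2 (B : set (set nat)) (hcount : countable B)
  (hbool : boolean_algebra B) (hfin : finite_difference_closed B) :
  medvedev_le (MAD_problem B) (tower_problem B) /\
  medvedev_le (tower_problem B) (MAD_problem B).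
Proof.
split.
- exists Differences => _ [G maxG <-].
  exists (charfun (of_columns (tower_differences G))).
    by exists (of_columns (tower_differences G)) => //; exact: MAD_of_maximal_tower.
  by apply: eval_of_columns => u n; exact: eval_Differences.
- exists Complements => _ [F madF <-].
  exists (charfun (of_columns (complement_before F))).
    by exists (of_columns (complement_before F)) => //; exact: maximal_tower_of_MAD.
  by apply: eval_of_columns => u n; exact: eval_Complements.
Qed.
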